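(* An isolate-free graph $G$ is $\gamma_{tg}'$-perfect if and only if it is a cograph.
   Context: Graphs are finite, simple, undirected, with at least one vertex, not necessarily connected. A cograph is a graph containing no induced path $P_4$ on four vertices. A graph is isolate-free if it has no vertex of degree $0$. A vertex totally dominates its neighbors (not itself). For an isolate-free graph $G$, $\gamma_t(G)$ is the total domination number, i.e. the minimum size of a set $S\subseteq V(G)$ such that every vertex of $G$ has a neighbor in $S$. Total domination game on an isolate-free graph $G$: Dominator and Staller alternately select vertices; each selected vertex must totally dominate at least one vertex not totally dominated by the previously selected vertices. The game ends when no legal move exists. Dominator wants to minimize and Staller to maximize the total number of moves. $\gamma_{tg}'(G)$ is the number of moves under optimal play when Staller starts. $G$ is $\gamma_{tg}'$-perfect if every isolate-free induced subgraph $F$ of $G$ satisfies $\gamma_{tg}'(F)=\gamma_t(F)$. *)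

(* Defs.v *)
From mathcomp Require Import all_boot.

Set Implicit Arguments.
Unset Strict Implicit.
Unset Printing Implicit Defensive.

Record sgraph := SGraph {
  svertex :> finType;
  sedge : rel svertex;
  sedge_sym : symmetric sedge;
  sedge_irrefl : irreflexive sedge }.

Section Induced.
Variables (G : sgraph) (S : {set G}).

Definition induced_rel : rel {x : G | x \in S} :=
  fun x y => sedge (val x) (val y).

Lemma induced_sym : symmetric induced_rel.
Proof. by move=> x y; apply: sedge_sym. Qed.

Lemma induced_irrefl : irreflexive induced_rel.
Proof. by move=> x; apply: sedge_irrefl. Qed.

Definition induced : sgraph := SGraph induced_sym induced_irrefl.
End Induced.

Definition isomorphic (G H : sgraph) : Prop :=
  exists2 f : G -> H, bijective f & forall x y, sedge (f x) (f y) = sedge x y.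

Section PathGraph.
Variable n : nat.

Definition path_rel : rel 'I_n := fun i j => (i.+1 == j) || (j.+1 == i).

Lemma path_rel_sym : symmetric path_rel.
Proof. by move=> i j; rewrite /path_rel orbC. Qed.

Lemma path_rel_irrefl : irreflexive path_rel.
Proof. by move=> i; rewrite /path_rel orbb; apply/negbTE; rewrite neq_ltn ltnSn orbT. Qed.

Definition path_graph : sgraph := SGraph path_rel_sym path_rel_irrefl.
End PathGraph.

Definition cograph (G : sgraph) : Prop :=
  ~ exists S : {set G}, isomorphic (path_graph 4) (induced S).

Section TotalDomination.
Variable G : sgraph.
Implicit Types (S : {set G}) (v x : G).

Definition isolate_free : bool := [forall x : G, exists y : G, sedge x y].

Definition tdom S : {set G} := [set x | [exists v in S, sedge v x]].

Definition total_dominating S : bool := tdom S == setT.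

(* The default setT is total dominating exactly when G is isolate-free; the
   value is meaningful only in that case. *)
Definition gamma_t : nat := #|[arg min_(S < setT | total_dominating S) #|S|]|.

Inductive player := Dominator | Staller.

Definition other (p : player) : player :=
  if p is Dominator then Staller else Dominator.

(* S is the set of vertices selected so far; reselecting is excluded
   automatically, see legal_notin below. *)
Definition legal S v : bool := [exists x, sedge v x && (x \notin tdom S)].

(* Number of moves still to be played, under optimal play, when the vertices
   of S have been selected and p is to move. The fuel n truncates the play
   after n moves; #|G| is always enough, see optimal_movesE below. *)
Fixpoint optimal_moves_rec (n : nat) (p : player) (S : {set G}) : nat :=
  if n is n'.+1 then
    let after v := optimal_moves_rec n' (other p) (v |: S) in
    if [pick v | legal S v] is Some v0 then
      (after (match p with
              | Dominator => [arg min_(v < v0 | legal S v) after v]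
              | Staller => [arg max_(v > v0 | legal S v) after v]
              end)).+1
    else 0
  else 0.

Definition optimal_moves : player -> {set G} -> nat := optimal_moves_rec #|G|.

Lemma legal_notin S v : legal S v -> v \notin S.
Proof.
case/existsP=> x /andP[vx]; apply: contra => vS.
by rewrite inE; apply/existsP; exists v; rewrite vS.
Qed.

Lemma card_setC_legal S v : legal S v -> #|~: S| = #|~: (v |: S)|.+1.
Proof.
move/legal_notin => vS.
by rewrite setCU setIC -setDE (cardsD1 v (~: S)) inE vS.
Qed.

Lemma optimal_moves_rec_fuel m n p S :
  #|~: S| <= m -> #|~: S| <= n ->
  optimal_moves_rec m p S = optimal_moves_rec n p S.
Proof.
elim: m n p S => [|m IH] [|n] p S //= hm hn.
- by case: pickP => // v /card_setC_legal h; rewrite h in hm.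
- by case: pickP => // v /card_setC_legal h; rewrite h in hn.
case: pickP => // v0 Lv0.
have E v : legal S v -> optimal_moves_rec m (other p) (v |: S)
                       = optimal_moves_rec n (other p) (v |: S).
  by move/card_setC_legal => Lv; apply: IH; rewrite -ltnS -Lv.
congr _.+1; case: p E => E.
- case: arg_minnP => // i Li Hi; case: arg_minnP => // j Lj Hj.
  apply/eqP; rewrite eqn_leq (leq_trans (Hi j Lj)) ?E //=.
  exact: Hj.
- case: arg_maxnP => // i Li Hi; case: arg_maxnP => // j Lj Hj.
  apply/eqP; rewrite eqn_leq (leq_trans _ (Hi j Lj)) ?E // andbT.
  exact: Hj.
Qed.

Lemma optimal_movesE p S :
  let after v := optimal_moves (other p) (v |: S) in
  optimal_moves p S =
    if [pick v | legal S v] is Some v0 then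
      (after (match p with
              | Dominator => [arg min_(v < v0 | legal S v) after v]
              | Staller => [arg max_(v > v0 | legal S v) after v]
              end)).+1
    else 0.
Proof.
rewrite /= /optimal_moves (@optimal_moves_rec_fuel _ #|G|.+1) //.
  exact: max_card.
exact/leqW/max_card.
Qed.

(* The prime refers to the Staller-start game. *)
Definition gamma_tg' : nat := optimal_moves Staller set0.
End TotalDomination.

Definition gamma_tg'_perfect (G : sgraph) : Prop :=
  forall S : {set G}, S != set0 -> isolate_free (induced S) ->
    gamma_tg' (induced S) = gamma_t (induced S).

(* Main.v *)
Require Import Defs.
From mathcomp Require Import all_boot.

Set Implicit Arguments.
Unset Strict Implicit.
Unset Printing Implicit Defensive.

(** If [a - b - c - d] is an induced path, Staller opens with [a]: no single
    reply completes a total dominating set, since the only neighbors of [a] and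
    [d] are [b] and [c], so the game lasts at least 3 moves while [{b, c}]
    totally dominates.

    Conversely, in a P4-free graph every non-isolated vertex [v] has a neighbor
    [u] such that [N(u) :|: N(v)] is the whole component of [v]. Dominator
    answers each move [v] of Staller with such a [u]. A total dominating set
    has at least two vertices in each component, so the game is over after at
    most [gamma_t] moves. *)

(** Degenerate walks are harmless: if [a = c] or [b = d], the conclusion is one of the given edges,
    and [a = d] contradicts [~~ sedge a c]. *)
Definition P4_free (G : sgraph) : Prop :=
  forall a b c d : G, sedge a b -> sedge b c -> sedge c d ->
    ~~ sedge a c -> ~~ sedge b d -> sedge a d.

(** As edges are symmetric, such sets are exactly the unions of components. *)
Definition edge_closed (G : sgraph) (A : {set G}) : Prop :=
  forall x y : G, x \in A -> sedge x y -> y \in A.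

Section TotalDominationGame.
Context {G : sgraph}.
Implicit Types (S A D : {set G}) (u v w x y : G).

Lemma edge_neq x y : sedge x y -> x != y.
Proof. by apply: contraTneq => ->; rewrite sedge_irrefl. Qed.

Lemma tdomP S x : reflect (exists2 v, v \in S & sedge v x) (x \in tdom S).
Proof. by rewrite inE; apply: (iffP exists_inP). Qed.

Lemma tdomU1 v S x : (x \in tdom (v |: S)) = sedge v x || (x \in tdom S).
Proof.
apply/tdomP/orP => [[w /setU1P[->|wS] wx]|[vx|/tdomP[w wS wx]]].
- by left.
- by right; apply/tdomP; exists w.
- by exists v; rewrite ?setU11.
- by exists w; rewrite // setU1r.
Qed.

Lemma tdom0 : tdom set0 = set0 :> {set G}.
Proof. by apply/setP => x; rewrite in_set0; apply/tdomP => -[v]; rewrite inE. Qed.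

Lemma tdom1 v x : (x \in tdom [set v]) = sedge v x.
Proof. by rewrite -[[set v]]setU0 tdomU1 tdom0 inE orbF. Qed.

Lemma total_dominatingP S : reflect (forall x, x \in tdom S) (total_dominating S).
Proof.
apply: (iffP eqP) => [-> x|h]; first by rewrite inE.
by apply/setP => x; rewrite h inE.
Qed.

Lemma isolate_free_total_dominating :
  isolate_free G -> @total_dominating G setT.
Proof.
move/forallP => h; apply/total_dominatingP => x; apply/tdomP.
by have /existsP[y xy] := h x; exists y; rewrite ?inE // sedge_sym.
Qed.

Lemma gamma_t_min S :
  isolate_free G -> total_dominating S -> gamma_t G <= #|S|.
Proof.
move/isolate_free_total_dominating => hT hS; rewrite /gamma_t.
by case: arg_minnP => // D _; apply.
Qed.

Lemma gamma_t_witness :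
  isolate_free G -> exists2 D : {set G}, total_dominating D & #|D| = gamma_t G.
Proof.
move/isolate_free_total_dominating => hT; rewrite /gamma_t.
by case: arg_minnP => // D hD _; exists D.
Qed.

Lemma no_legal_total_dominating S :
  isolate_free G -> legal S =1 xpred0 -> total_dominating S.
Proof.
move=> /forallP hG h; apply/total_dominatingP => x.
have /existsP[y xy] := hG x; move/negbT/existsPn: (h y) => /(_ x).
by rewrite sedge_sym xy negbK.
Qed.

(** * Values of game positions *)

Lemma optimal_moves_no_legal p S :
  legal S =1 xpred0 -> optimal_moves p S = 0.
Proof. by move=> h; rewrite optimal_movesE; case: pickP => // v; rewrite h. Qed.

Lemma optimal_moves_legal p S v : legal S v ->
  exists2 w, legal S w &
    optimal_moves p S = (optimal_moves (other p) (w |: S)).+1.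
Proof.
move=> Lv; rewrite optimal_movesE; case: pickP => [v0 Lv0|/(_ v)]; last first.
  by rewrite Lv.
case: p => /=.
- by case: arg_minnP => // w Lw _; exists w.
- by case: arg_maxnP => // w Lw _; exists w.
Qed.

Lemma optimal_moves_gt0 p S :
  isolate_free G -> ~~ total_dominating S -> 0 < optimal_moves p S.
Proof.
move=> hG hS; case: (pickP (legal S)) => [v Lv|h].
  by have [w _ ->] := optimal_moves_legal p Lv.
by rewrite no_legal_total_dominating in hS.
Qed.

Lemma optimal_moves_Dominator_le S v : legal S v ->
  optimal_moves Dominator S <= (optimal_moves Staller (v |: S)).+1.
Proof.
move=> Lv; rewrite optimal_movesE; case: pickP => // v0 Lv0.
by rewrite ltnS /=; case: arg_minnP => // w _; apply.
Qed.

Lemma optimal_moves_Staller_gt S v : legal S v ->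
  optimal_moves Dominator (v |: S) < optimal_moves Staller S.
Proof.
move=> Lv; rewrite (optimal_movesE Staller); case: pickP => [v0 Lv0|/(_ v)].
  by rewrite ltnS /=; case: arg_maxnP => // w _; apply.
by rewrite Lv.
Qed.

(** However the game is played, the final set is total dominating, and each move adds one new vertex
    to [S]. *)
Lemma gamma_t_le_optimal_moves p S :
  isolate_free G -> gamma_t G <= #|S| + optimal_moves p S.
Proof.
move=> hG; have [n] := ubnP #|~: S|.
elim: n p S => // n IH p S hn; case: (pickP (legal S)) => [v Lv|h]; last first.
  by apply: leq_trans (leq_addr _ _); apply/gamma_t_min/no_legal_total_dominating.
have [w Lw ->] := optimal_moves_legal p Lv.
(* The summand [true] is the truth value of [w \notin S], as [cardsU1] has it. *)
rewrite addnS -addSn -[#|S|.+1]/(true + #|S|) -(legal_notin Lw) -cardsU1.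
by apply: IH; rewrite -ltnS -(card_setC_legal Lw).
Qed.

(* The reply [u] is a neighbor of [v] with [#|N(u) :|: N(v)|] maximal. *)
Lemma component_reply v : P4_free G -> (exists y, sedge v y) ->
  exists2 u, sedge v u & edge_closed (tdom [set u; v]).
Proof.
move=> hP [y0 vy0].
have domE u x : (x \in tdom [set u; v]) = sedge u x || sedge v x.
  by rewrite tdomU1 tdom1.
case: (@arg_maxnP _ y0 (sedge v) (fun u => #|tdom [set u; v]|)) => // u vu umax.
exists u => // w z; rewrite !domE => hw wz.
case uz: (sedge u z) => //; case vz: (sedge v z) => //=.
have sym := @sedge_sym G.
(* If [w] is not adjacent to [v], then [v - u - w - z] is an induced path. *)
case vw: (sedge v w); last first.
  rewrite vw orbF in hw.
  by rewrite (hP v u w z) ?vw ?uz in vz.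
(* Now [w] competes with [u] in the maximum and dominates the extra vertex [z], so it must miss some
   neighbor [y] of [u]. *)
have /subsetPn[y] : ~~ (tdom [set u; v] \subset tdom [set w; v]).
  apply/negP => sub; have := umax _ vw; rewrite /= leqNgt => /negP; apply.
  apply: proper_card; apply/properP; split=> //.
  by exists z; rewrite domE ?wz // uz vz.
rewrite !domE negb_or => hy /andP[wy vy]; rewrite (negbTE vy) orbF in hy.
case uw: (sedge u w).
(* The path [y - u - w - z] forces the edge [y z]; then [z - y - u - v] forces the excluded edge
   [z v]. *)
- have yz : sedge y z by apply: (hP y u w z); rewrite // ?uz // sym.
  have : sedge z v; last by rewrite sym vz.
  by apply: (hP z y u v); rewrite // sym ?uz.
- have : sedge y w; last by rewrite sym (negbTE wy).
  by apply: (hP y u v w); rewrite ?uw // sym.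
Qed.

(** Before each move of Staller the dominated set is a union of components. A round of two moves
    adds the component of [v] to it, and with it at least two vertices of [D]. *)
Lemma optimal_moves_le S D : P4_free G -> isolate_free G ->
  total_dominating D -> edge_closed (tdom S) ->
  optimal_moves Staller S <= #|D :\: tdom S|.
Proof.
move=> hP hG /total_dominatingP hD; have sym := @sedge_sym G.
have [n] := ubnP #|D :\: tdom S|; elim: n S => // n IH S hn clS.
case: (pickP (legal S)) => [v0 Lv0|/optimal_moves_no_legal->] //.
have [v Lv ->] := optimal_moves_legal Staller Lv0 => {v0 Lv0}.
(* Were [v] dominated, closure would put all its neighbors in [tdom S], and the move would be
   illegal. *)
have vS : v \notin tdom S.
  case/existsP: Lv => x /andP[vx]; apply: contra => vS; exact: clS vx.
have [|u vu clu] := @component_reply v hP; first exact/existsP/(forallP hG).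
have Lu : legal (v |: S) u.
  apply/existsP; exists v.
  by rewrite sym vu tdomU1 sedge_irrefl.
have domE x : (x \in tdom (u |: (v |: S))) =
              (x \in tdom [set u; v]) || (x \in tdom S).
  by rewrite !tdomU1 tdom1 orbA.
have clS' : edge_closed (tdom (u |: (v |: S))).
  move=> x y; rewrite !domE => /orP[/clu|/clS] h xy; first by rewrite h.
  by rewrite (h y) ?orbT.
(* [d] and [d'] are adjacent vertices of [D] in the component of [v]: the two that this round
   removes from [D :\: tdom S]. *)
have [d dD dv] := tdomP _ _ (hD v).
have [d' d'D d'd] := tdomP _ _ (hD d).
have dS : d \notin tdom S by apply: contra vS => /clS; apply.
have d'S : d' \notin tdom S by apply: contra dS => /clS; apply.
have dS' : d \in tdom (u |: (v |: S)) by rewrite !tdomU1 (sym v) dv orbT.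
have d'S' : d' \in tdom (u |: (v |: S)) by apply: clS' dS' _; rewrite sym.
have le2 : (#|D :\: tdom (u |: (v |: S))|).+2 <= #|D :\: tdom S|.
  rewrite (cardsD1 d (D :\: tdom S)) (cardsD1 d' (_ :\ d)) !in_setD1 !in_setD.
  rewrite dS d'S dD d'D (edge_neq d'd) !add1n !ltnS.
  apply/subset_leq_card/subsetP => x; rewrite !in_setD1 !in_setD.
  case/andP => xS' ->; rewrite andbT.
  rewrite (contraNneq _ xS') => [|->] //=; rewrite (contraNneq _ xS') => [|->] //=.
  by apply: contra xS'; rewrite domE orbC => ->.
apply: leq_trans (le2); rewrite ltnS.
apply: leq_trans (optimal_moves_Dominator_le Lu) _; rewrite ltnS.
by apply: IH => //; apply: leq_trans (ltnW le2) _.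
Qed.

End TotalDominationGame.

(** * Cographs and induced paths *)

Lemma cograph_P4_free (G : sgraph) : cograph G -> P4_free G.
Proof.
move=> hG a b c d ab bc cd ac bd; apply: contraT => ad; case: hG.
pose g (i : 'I_4) := nth a [:: a; b; c; d] i.
have sym := @sedge_sym G.
have gE (i j : 'I_4) : sedge (g i) (g j) = path_rel i j.
  case: i => -[|[|[|[|//]]]] ?; case: j => -[|[|[|[|//]]]] ?;
  rewrite /g /path_rel /= ?sedge_irrefl ?ab ?bc ?cd ?(negbTE ac)
    ?(negbTE bd) ?(negbTE ad) // sym ?ab ?bc ?cd ?(negbTE ac)
    ?(negbTE bd) ?(negbTE ad) //.
(* Distinct vertices of the path have distinct neighborhoods, and [g] preserves and reflects
   adjacency. *)
have ginj : injective g.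
  move=> i j gij.
  have h k : path_rel i k = path_rel j k by rewrite -!gE gij.
  apply/val_inj; move: h {gij}.
  case: i => -[|[|[|[|//]]]] ?; case: j => -[|[|[|[|//]]]] ? //= h;
  by have := (h (@Ordinal 4 0 isT), h (@Ordinal 4 1 isT),
     h (@Ordinal 4 2 isT), h (@Ordinal 4 3 isT)) => -[[[]]].
exists [set g i | i in 'I_4].
exists (fun i => exist _ (g i) (imset_f g (isT : i \in 'I_4))).
- apply: inj_card_bij => [i j [/ginj] //|].
  by rewrite card_sig; apply: leq_imset_card.
- by move=> i j; apply: gE.
Qed.

Lemma induced_P4_free (G : sgraph) (S : {set G}) :
  P4_free G -> P4_free (induced S).
Proof. by move=> hG a b c d; apply: hG. Qed.

Lemma P4_free_gamma_tg' (G : sgraph) :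
  P4_free G -> isolate_free G -> gamma_tg' G = gamma_t G.
Proof.
move=> hP hG; apply/eqP; rewrite eqn_leq; apply/andP; split; last first.
  by have := @gamma_t_le_optimal_moves G Staller set0 hG; rewrite cards0.
have [D hD <-] := gamma_t_witness hG.
rewrite -[D]setD0 -tdom0; apply: optimal_moves_le => //.
by rewrite tdom0 => x y; rewrite inE.
Qed.

Lemma path4_isolate_free (H : sgraph) :
  isomorphic (path_graph 4) H -> isolate_free H.
Proof.
case=> f [g _ fK] fE; apply/forallP => x; rewrite -(fK x).
apply/existsP; case: (g x) => -[|[|[|[|//]]]] lt4.
- by exists (f (@Ordinal 4 1 isT)); rewrite fE.
- by exists (f (@Ordinal 4 0 isT)); rewrite fE.
- by exists (f (@Ordinal 4 3 isT)); rewrite fE.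
- by exists (f (@Ordinal 4 2 isT)); rewrite fE.
Qed.

Lemma path4_gamma_t_le (H : sgraph) :
  isomorphic (path_graph 4) H -> gamma_t H <= 2.
Proof.
move=> iH; have hH := path4_isolate_free iH; case: iH => f [g _ fK] fE.
pose b := f (@Ordinal 4 1 isT); pose c := f (@Ordinal 4 2 isT).
have le2 : #|[set b; c]| <= 2 by rewrite cards2; case: eqP.
apply: leq_trans le2; apply: gamma_t_min => //.
apply/total_dominatingP => x; rewrite tdomU1 tdom1 -(fK x).
by rewrite !fE; case: (g x) => -[|[|[|[|//]]]] ?.
Qed.

Lemma path4_gamma_tg'_ge (H : sgraph) :
  isomorphic (path_graph 4) H -> 2 < gamma_tg' H.
Proof.
move=> iH; have hH := path4_isolate_free iH; case: iH => f [g gK fK] fE.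
pose a := f (@Ordinal 4 0 isT).
(* [u] would have to dominate both ends of the path, which have no common neighbor; [a] dominates
   neither. *)
have not_td u : ~~ total_dominating (u |: (a |: set0)).
  apply/negP => /total_dominatingP h.
  have := h a; have := h (f (@Ordinal 4 3 isT)).
  rewrite !tdomU1 -(fK u) !fE.
  rewrite tdom0 !inE !orbF.
  by case: (g u) => -[|[|[|[|//]]]] ?.
have La : legal set0 a.
  apply/existsP; exists (f (@Ordinal 4 1 isT)); rewrite fE.
  by rewrite tdom0 inE.
apply: leq_ltn_trans (optimal_moves_Staller_gt La).
(* The game cannot stop after [a], by [not_td] with [u = a]. *)
have [v Lv|h] := pickP (legal (a |: set0)); last first.
  have := not_td a; rewrite setUA setUid.
  by rewrite no_legal_total_dominating.
have [w _ ->] := optimal_moves_legal Dominator Lv.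
by rewrite ltnS; apply: optimal_moves_gt0.
Qed.

Theorem proposition5p3 (G : sgraph) (G_nonempty : 0 < #|G|)
    (G_isolate_free : isolate_free G) :
  gamma_tg'_perfect G <-> cograph G.
Proof.
split=> [hG [S iS]|/cograph_P4_free hG S _ hS]; last first.
  exact/P4_free_gamma_tg'/hS/induced_P4_free.
(* The induced path itself violates perfection: its game lasts more than 2 moves, while [gamma_t] is
   at most 2. *)
have := path4_gamma_tg'_ge iS; rewrite hG ?ltnNge ?path4_gamma_t_le //.
- by case: iS => f _ _; apply/set0Pn; exists (val (f ord0)); apply: valP.
- exact: path4_isolate_free.
Qed.
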